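(* Let $R$ be a $\ast$-ring. The following conditions are equivalent: (1) $R$ is pro-$\ast$-reversible. (2) For all $a,b\in R$, $ab\in P(R)$ implies $ab^{\ast}=b^{\ast}a\in P(R)$.
   Context: All rings are associative with unity. A $\ast$-ring is a ring $R$ equipped with an involution $\ast$, i.e. a map $\ast:R\to R$ with $(x+y)^{\ast}=x^{\ast}+y^{\ast}$, $(xy)^{\ast}=y^{\ast}x^{\ast}$ and $(x^{\ast})^{\ast}=x$ for all $x,y\in R$. $P(R)$ is the set of projections of $R$, i.e. elements $p$ with $p=p^{2}=p^{\ast}$. A $\ast$-ring $R$ is pro-$\ast$-reversible if for all $a,b\in R$, $ab\in P(R)$ implies $b^{\ast}a\in P(R)$. *)

(* Defs.v *)
From mathcomp Require Import all_boot all_algebra.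

Set Implicit Arguments.
Unset Strict Implicit.
Unset Printing Implicit Defensive.

Import GRing.Theory.
Local Open Scope ring_scope.

(* [pzRingType] is the class of associative unital rings, zero ring included. *)
Definition ring_involution (R : pzRingType) (star : R -> R) : Prop :=
  [/\ {morph star : x y / x + y},
      forall x y : R, star (x * y) = star y * star x
    & involutive star].

Definition projection (R : pzRingType) (star : R -> R) (p : R) : Prop :=
  p = p ^+ 2 /\ p = star p.

Definition pro_star_reversible (R : pzRingType) (star : R -> R) : Prop :=
  forall a b : R, projection star (a * b) -> projection star (star b * a).

(* Main.v *)
Require Import Defs.
From mathcomp Require Import all_boot all_algebra.

Set Implicit Arguments.
Unset Strict Implicit.
Unset Printing Implicit Defensive.

Import GRing.Theory.
Local Open Scope ring_scope.

(** Pro-star-reversibility makes every projection [e] central: for each [r],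
    the idempotent [g = e + e r (1 - e)] satisfies [g e = e], so reversibility
    turns [e^* g = e g = g] into a projection, and a self-adjoint [g] with [g e = e]
    and [e g = g] is equal to [e].

    If [a b] is a projection, reversibility applied to [a b = b^* a^*] makes
    [a b^*] a projection as well as [b^* a].  With [x = a] and [y = b^*] both
    [x y] and [y x] are thus central idempotents, and two such products agree:
    [x y = x (y x) y = (y x) (x y)], while [y x = y (x y) x = (y x) (x y)]. *)

Lemma central_idempotent_mulC (R : pzRingType) (x y : R) :
  x * y = (x * y) ^+ 2 -> y * x = (y * x) ^+ 2 ->
  (forall r, GRing.comm (x * y) r) -> (forall r, GRing.comm (y * x) r) ->
  x * y = y * x.
Proof.
move=> idxy idyx Cxy Cyx.
have -> : x * y = (y * x) * (x * y).
  by rewrite {1}idxy expr2 -mulrA [y * (x * y)]mulrA mulrA -Cyx -!mulrA.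
by rewrite {2}idyx expr2 -[RHS]mulrA [x * (y * x)]mulrA Cxy !mulrA.
Qed.

(** This is the vanishing of the Peirce corner [e R (1 - e)]; the opposite
    corner is its adjoint, so it vanishes as well and [e] is central. *)
Lemma projection_corner (R : pzRingType) (star : R -> R) (e r : R) :
  ring_involution star -> pro_star_reversible star ->
  projection star e -> e * r = e * r * e.
Proof.
move=> [_ starM _] rev pe; have [e2 es] := pe.
have ee : e * e = e by rewrite -expr2 -e2.
pose g := e + (e * r - e * r * e).
have ge : g * e = e.
  by rewrite /g mulrDl mulrBl -(mulrA (e * r)) ee subrr addr0.
have eg : e * g = g by rewrite /g mulrDr mulrBr !mulrA !ee.
have [_ gs] : projection star g.
  by have := @rev g e; rewrite ge -es eg; apply.
have g_e : g = e by rewrite -eg [in LHS]gs [e in LHS]es -starM ge -es.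
by apply/eqP; rewrite -subr_eq0; apply/eqP/(addrI e); rewrite addr0.
Qed.

Lemma projection_central (R : pzRingType) (star : R -> R) (e : R) :
  ring_involution star -> pro_star_reversible star ->
  projection star e -> forall r, GRing.comm e r.
Proof.
move=> star_inv rev pe r.
have [_ starM starK] := star_inv; have [_ es] := pe.
have /(congr1 star) := projection_corner (star r) star_inv rev pe.
rewrite !starM starK -es mulrA => re.
by rewrite /GRing.comm (projection_corner r star_inv rev pe) re.
Qed.

Theorem corollary3p4 (R : pzRingType) (star : R -> R)
    (star_inv : ring_involution star) :
  pro_star_reversible star <->
  (forall a b : R, projection star (a * b) ->
     a * star b = star b * a /\ projection star (star b * a)).
Proof.
split=> [rev a b pab|H a b /H[]//].
have [_ starM starK] := star_inv.
have pba := rev _ _ pab.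
have pab' : projection star (a * star b).
  by rewrite -[a]starK; apply: rev; rewrite -starM; case: (pab) => _ <-.
split=> //; have C p := @projection_central _ _ p star_inv rev.
by apply: central_idempotent_mulC (C _ pab') (C _ pba); [case: pab' | case: pba].
Qed.
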